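(* For all positive integers $u,v$, $\Phi(u\times v,4,2)\le J^*(u\times v)$.
   Context: A 2-D $(u\times v,4,2)$-OOC is a family $\mathcal C$ of $u\times v$ $(0,1)$-matrices of Hamming weight $4$ such that for all $A=(a_{ij}),B=(b_{ij})\in\mathcal C$ and integers $r$ with $A\ne B$ or $r\not\equiv0\pmod v$, $\sum_{i,j}a_{ij}b_{i,j+r}\le 2$ (column indices mod $v$). $\Phi(u\times v,4,2)$ is the largest size of such a code. Write $N=\lfloor\frac{uv-1}{3}\lfloor\frac{uv-2}{2}\rfloor\rfloor$. Let $A=\{(u,v):u\equiv0\ (\mathrm{mod}\ 12),\ v\equiv2,4\ (\mathrm{mod}\ 6)\}$ and $B=\{(u,v):uv\equiv0\ (\mathrm{mod}\ 12),\ v\equiv0\ (\mathrm{mod}\ 6)\}$. Define $J^*(u\times v)$ as: $\lfloor\frac{u}{4}N\rfloor-1$ if $u\equiv7,11\pmod{12}$ and $v=2$; $\lfloor\frac{u}{4}(N-1)\rfloor$ if either ($uv\equiv0\pmod 6$ and $(u,v)\notin A\cup B$) or ($uv\equiv4,8\pmod{12}$ and $v$ even); $\lfloor\frac{u}{4}(N-1)\rfloor-1$ if $(u,v)\in A$; $\lfloor\frac{u}{4}(N-2)\rfloor$ if $(u,v)\in B$; and $\lfloor\frac{u}{4}N\rfloor$ otherwise. *)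

(* Defs.v *)
From mathcomp Require Import all_boot all_order all_algebra.
Set Implicit Arguments. Unset Strict Implicit. Unset Printing Implicit Defensive.

Lemma shift_lt (v : nat) (j r : 'I_v) : (j + r) %% v < v.
Proof. by rewrite ltn_pmod // (leq_ltn_trans (leq0n j) (ltn_ord j)). Qed.

Definition colshift (v : nat) (j r : 'I_v) : 'I_v := Ordinal (shift_lt j r).

Definition hweight (u v : nat) (A : 'M[bool]_(u, v)) : nat :=
  \sum_(i < u) \sum_(j < v) (A i j : nat).

Definition corr (u v : nat) (A B : 'M[bool]_(u, v)) (r : 'I_v) : nat :=
  \sum_(i < u) \sum_(j < v) ((A i j && B i (colshift j r)) : nat).

(* A 2-D (u x v, 4, 2)-OOC: every shift r in Z is represented mod v by r : 'I_v,
   and r = 0 mod v iff r = 0 as an ordinal. *)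
Definition is_OOC (u v : nat) (C : {set 'M[bool]_(u, v)}) : bool :=
  [forall A in C, hweight A == 4] &&
  [forall A in C, forall B in C, forall r : 'I_v,
      ((A != B) || (r != 0 :> nat)) ==> (corr A B r <= 2)].

(* Largest size of such a code (the empty code is always an OOC). *)
Definition Phi (u v : nat) : nat :=
  \max_(C : {set 'M[bool]_(u, v)} | is_OOC C) #|C|.

Definition Nval (u v : nat) : nat := ((u * v - 1) * ((u * v - 2) %/ 2)) %/ 3.

Definition inA (u v : nat) : bool := (u %% 12 == 0) && ((v %% 6 == 2) || (v %% 6 == 4)).
Definition inB (u v : nat) : bool := (u * v %% 12 == 0) && (v %% 6 == 0).

Definition Jstar (u v : nat) : nat :=
  let N := Nval u v in
  if ((u %% 12 == 7) || (u %% 12 == 11)) && (v == 2) then (u * N) %/ 4 - 1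
  else if ((u * v %% 6 == 0) && ~~ (inA u v || inB u v))
          || (((u * v %% 12 == 4) || (u * v %% 12 == 8)) && ~~ odd v)
       then (u * (N - 1)) %/ 4
  else if inA u v then (u * (N - 1)) %/ 4 - 1
  else if inB u v then (u * (N - 2)) %/ 4
  else (u * N) %/ 4.

(* Main.v *)
Require Import Defs.
From mathcomp Require Import all_boot all_order all_algebra.
From mathcomp Require Import zify.

Set Implicit Arguments. Unset Strict Implicit. Unset Printing Implicit Defensive.
Import GRing.Theory.

(** The v cyclic shifts of the codewords form a family of quadruples on the
    n = uv points, any two of which share at most two points, and the number
    d_i of quadruples through a point depends only on its row i; counting
    incidences gives 4|C| = sum_i d_i. For a point x the triples {x, p, q}
    contained in no quadruple are the edges of a graph L_x with
    6 d_x + sum_p deg p = (n - 1)(n - 2), whose degrees are all even if n is.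
    If 6 divides n, the degree sum is 2 mod 6, and 2 is impossible for an even
    simple graph, so it is at least 8. If v is even, x |-> x + v/2 permutes the
    quadruples through x and x + v/2 without fixed quadruple, so x + v/2 has
    degree n - 2 mod 4 in L_x. If 12 divides n and the degree sum is 8, this
    makes L_x a 4-cycle through x + v/2 in which no two vertices differ by v/2;
    a neighbour a of x + v/2 then has the edge {x, x + v/2} in L_a, so L_a is
    not of this kind. When 3 divides v, the triple {x, x + v/3, x + 2v/3} is in
    no quadruple, which forces such an a into the row of x. For v = 2 and
    u = 7, 11 mod 12, attaining the bound would confine the uncovered triples
    to four points, where the congruence modulo 4 excludes them. *)

(** * Counting preliminaries *)

Lemma leq_sum_uniq (T : finType) (F : T -> nat) (s : seq T) :
  uniq s -> \sum_(p <- s) F p <= \sum_p F p.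
Proof.
move=> us; rewrite (big_uniq _ us) /= [leqRHS](bigID (mem s)) /=.
exact: leq_addr.
Qed.

(** Induction on a size bound removes one orbit [{x, f x}] at a time. *)
Lemma odd_card_involution (T : finType) (f : T -> T) (S : {set T}) :
  involutive f -> (forall x, x \in S -> f x \in S) ->
  (forall x, x \in S -> f x != x) -> ~~ odd #|S|.
Proof.
move=> fK; move: {2}#|S| (leqnn #|S|) => n; elim: n S => [|n IHn] S.
  by rewrite leqn0 => /eqP->.
move=> leSn fS fne; case: (set_0Vmem S) => [->|[x xS]]; first by rewrite cards0.
have fxS : f x \in S :\ x by rewrite !inE fne ?fS.
rewrite (cardsD1 x) xS (cardsD1 (f x)) fxS /= negbK.
move: leSn; rewrite (cardsD1 x) xS (cardsD1 (f x)) fxS => leSn.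
apply: IHn => [|y|y]; first by lia.
- rewrite !inE => /and3P[yfx yx yS]; rewrite fS // andbT.
  by rewrite (inj_eq (inv_inj fK)) yx -(inj_eq (inv_inj fK)) fK.
- by rewrite !inE => /and3P[_ _]; apply: fne.
Qed.

(** * Simple graphs with even degrees *)

Section EvenGraph.
Variables (T : finType) (g : rel T).

Definition deg (p : T) : nat := #|[set q | g p q]|.

Hypotheses (gC : symmetric g) (gI : irreflexive g).
Hypothesis deg_even : forall p, ~~ odd (deg p).

Lemma deg_ge2 p q : g p q -> 2 <= deg p.
Proof.
move=> gpq; have := deg_even p.
have : 0 < deg p by apply/card_gt0P; exists q; rewrite inE.
by case: (deg p) => [|[]].
Qed.

Lemma deg_gt0_edge p : 0 < deg p -> exists q, g p q.
Proof. by case/card_gt0P => q; rewrite inE; exists q. Qed.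

Lemma sum_deg_ge (s : seq T) :
  uniq s -> all (fun p => 2 <= deg p) s -> size s * 2 <= \sum_p deg p.
Proof.
move=> us /allP s2; apply: leq_trans (leq_sum_uniq deg us).
have -> : size s * 2 = \sum_(p <- s) 2.
  by rewrite big_const_seq count_predT iter_addn_0 mulnC.
by rewrite [leqLHS]big_seq [leqRHS]big_seq leq_sum.
Qed.

Lemma edge_of_sum_deg : 0 < \sum_p deg p -> exists p q, g p q.
Proof.
rewrite lt0n => H; have [p /deg_gt0_edge[q gpq]|no] := pickP (fun p => 0 < deg p).
  by exists p, q.
case/negP: H; rewrite big1 // => p _; have := no p; lia.
Qed.

(** Both ends of an edge have positive even degree, so a nonzero sum is at least 4. *)
Lemma sum_deg_neq2 : \sum_p deg p != 2.
Proof.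
apply/eqP => H; have [|p [q gpq]] := edge_of_sum_deg; first by rewrite H.
have := @sum_deg_ge [:: p; q]; rewrite /= inE H.
rewrite (deg_ge2 gpq) (@deg_ge2 q p) 1?gC //.
case: eqP gpq => [->|_ _]; [by rewrite gI | by move/(_ isT isT)].
Qed.

Hypothesis sum8 : \sum_p deg p = 8.

(** Otherwise [p] has degree at least 4 and so has at least four neighbours, each of degree at least
    2: the sum is at least 12. *)
Lemma deg_le2 p : deg p <= 2.
Proof.
rewrite leqNgt; apply/negP => lt2.
have ge4 : 4 <= deg p by have := deg_even p; case: (deg p) lt2 => [|[|[|[]]]].
have := sum8; rewrite (bigD1 p) //=.
have : \sum_(q in [set q | g p q]) 2 <= \sum_(q | q != p) deg q.
  rewrite [leqRHS](bigID (mem [set q | g p q])) /=.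
  apply: leq_trans (leq_addr _ _).
  rewrite [leqRHS](eq_bigl (mem [set q | g p q])) => [|q].
    by apply: leq_sum => q; rewrite inE gC => /deg_ge2.
  by rewrite !inE; case: eqP => // ->; rewrite gI.
rewrite sum_nat_const -/(deg p); lia.
Qed.

Lemma nbr_cases p a b c : g p a -> g p b -> a != b -> g p c -> (c == a) || (c == b).
Proof.
move=> ga gb ab gc; apply/negPn/negP; rewrite negb_or => /andP[ca cb].
have : [set c; a; b] \subset [set q | g p q].
  by apply/subsetP => q; rewrite !inE => /orP[/orP[]|] /eqP->.
move/subset_leq_card; rewrite -setUA cardsU1 cards2 ab !inE negb_or ca cb.
by have := deg_le2 p; rewrite /deg; lia.
Qed.

(** As degrees are at most 2, a triangle is a whole component with degree sum 6. An edge elsewhere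
    gives five vertices of degree at least 2, hence a sum of at least 10; no edge elsewhere leaves
    the sum at 6. *)
Lemma triangle_free p q r : g p q -> g q r -> g p r = false.
Proof.
move=> gpq gqr; apply/negP => gpr.
have ne x y : g x y -> x != y by apply: contraTneq => ->; rewrite gI.
have utri : uniq [:: p; q; r] by rewrite /= !inE negb_or !ne.
have isol w z : g w z -> z \in [:: p; q; r] -> w \in [:: p; q; r].
  rewrite gC !inE => gzw /or3P[] /eqP ez; rewrite {}ez in gzw.
  - by case/orP: (nbr_cases gpq gpr (ne _ _ gqr) gzw) => ->; rewrite ?orbT.
  - rewrite gC in gpq.
    by case/orP: (nbr_cases gpq gqr (ne _ _ gpr) gzw) => ->; rewrite ?orbT.
  - rewrite gC in gpr; rewrite gC in gqr.
    by case/orP: (nbr_cases gpr gqr (ne _ _ gpq) gzw) => ->; rewrite ?orbT.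
have [w /andP[wn gw]|no] := pickP (fun w => (w \notin [:: p; q; r]) && (0 < deg w)).
  have [z gwz] := deg_gt0_edge gw.
  have zn : z \notin [:: p; q; r] by apply: contra wn => /(isol _ _ gwz).
  have /sum_deg_ge : uniq [:: w, z, p, q & [:: r]].
    by rewrite 2!cons_uniq utri zn inE (negbTE (ne _ _ gwz)) (negbTE wn).
  rewrite sum8 /= (deg_ge2 gwz) (deg_ge2 gpq) (deg_ge2 gqr).
  by rewrite (@deg_ge2 z w) 1?gC // (@deg_ge2 r p) 1?gC // => /(_ isT).
have := sum8; rewrite (bigID (mem [:: p; q; r])) /= [X in _ + X]big1; last first.
  by move=> w wn; have := no w; rewrite wn /=; lia.
rewrite -(big_uniq _ utri) /= !big_cons big_nil.
by have := deg_le2 p; have := deg_le2 q; have := deg_le2 r; lia.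
Qed.

(** If [p] is [a] or [s a], the edge closes a triangle with [y]. Otherwise [y], [a], [s a], [p],
    [s p] are five vertices of degree at least 2, too many for a sum of 8. *)
Lemma no_involution_edge (s : T -> T) (y p : T) :
  involutive s -> (forall q, s q != q) -> (forall q, g y q -> g y (s q)) ->
  0 < deg y -> (forall q, g (s y) q = false) -> g p (s p) = false.
Proof.
move=> sK sne gys /deg_gt0_edge[a gya] sy0; apply/negP => gp.
have gysa := gys _ gya.
have sE q r : (s q == r) = (q == s r) by rewrite -(inj_eq (inv_inj sK)) sK.
have [pa|pa] := boolP (p \in [:: a; s a]).
  have : g a (s a).
    by move: pa gp; rewrite !inE => /orP[] /eqP-> //; rewrite sK gC.
  by move/(triangle_free gya); rewrite gysa.
have := @sum_deg_ge [:: y; a; s a; p; s p].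
rewrite sum8 /= (deg_ge2 gya) (deg_ge2 gp) (@deg_ge2 a y) 1?gC //.
rewrite (@deg_ge2 (s a) y) 1?gC // (@deg_ge2 (s p) p) 1?gC //=.
move=> H; suff : false by [].
apply: H => //.
have ya : y != a by apply: contraTneq gya => ->; rewrite gI.
have ysa : y != s a by apply: contraTneq gysa => ->; rewrite gI.
(* Since [s y] is isolated, [y] cannot be an end of the edge from [p] to [s p]. *)
have yp : y != p by apply: contraTneq gp => <-; rewrite gC sy0.
have ysp : y != s p by apply: contraTneq gp => e; rewrite -(sK p) -e sy0.
move: pa; rewrite !inE negb_or => /andP[pa psa].
rewrite !negb_or ya ysa yp ysp (eq_sym a (s a)) (eq_sym p (s p)) !sne.
rewrite -sE (inj_eq (inv_inj sK)) (eq_sym a p) (eq_sym (s a)).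
by rewrite pa psa.
Qed.

(** An edge that avoids [y], [a] and [s a] would again give five vertices of degree at least 2. *)
Lemma involution_nbr_edge (s : T -> T) (y p q : T) :
  involutive s -> (forall q, s q != q) -> (forall q, g y q -> g y (s q)) ->
  0 < deg y -> g p q -> p != y -> q != y ->
  exists2 a, g y a & (a == p) || (a == q).
Proof.
move=> sK sne gys /deg_gt0_edge[a gya] gpq py qy.
have gysa := gys _ gya.
have [pa|pa] := boolP ((p \in [:: a; s a]) || (q \in [:: a; s a])).
  move: pa; rewrite !inE => /orP[] /orP[] /eqP e; rewrite {}e in gpq py qy *.
  - by exists a; rewrite ?eqxx.
  - by exists (s a); rewrite ?eqxx.
  - by exists a; rewrite ?eqxx ?orbT.
  - by exists (s a); rewrite ?eqxx ?orbT.
have := @sum_deg_ge [:: y; a; s a; p; q].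
rewrite sum8 /= (deg_ge2 gya) (deg_ge2 gpq) (@deg_ge2 a y) 1?gC //.
rewrite (@deg_ge2 (s a) y) 1?gC // (@deg_ge2 q p) 1?gC //=.
move=> H; suff : false by [].
apply: H => //.
have ya : y != a by apply: contraTneq gya => ->; rewrite gI.
have ysa : y != s a by apply: contraTneq gysa => ->; rewrite gI.
have pq : p != q by apply: contraTneq gpq => ->; rewrite gI.
move: pa; rewrite !inE !negb_or => /andP[/andP[pa psa] /andP[qa qsa]].
rewrite ya ysa pq (eq_sym y) py (eq_sym y) qy (eq_sym a (s a)) sne.
by rewrite (eq_sym a) pa (eq_sym a) qa (eq_sym (s a)) psa (eq_sym (s a)) qsa.
Qed.

End EvenGraph.

(** * Quadruples meeting pairwise in at most two points *)

Lemma card_set_sum (T : finType) (P : pred T) : #|[set q | P q]| = \sum_q (P q : nat).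
Proof.
by rewrite -sum1dep_card big_mkcond; apply: eq_bigr => q _; case: (P q).
Qed.

Lemma card3 (T : finType) (x p q : T) : x != p -> x != q -> p != q -> #|[set x; p; q]| = 3.
Proof.
by move=> xp xq pq; rewrite -setUA cardsU1 cards2 pq !inE negb_or xp xq.
Qed.

Lemma card_neq (T : finType) (x : T) : #|[pred p | p != x]| = #|T| - 1.
Proof. by rewrite subn1 -(cardC1 x). Qed.

Section QuadruplePacking.
Variables (T : finType) (Bs : {set {set T}}).
Hypothesis card_block : forall B, B \in Bs -> #|B| = 4.
Hypothesis block_inter :
  forall B B', B \in Bs -> B' \in Bs -> B != B' -> #|B :&: B'| <= 2.

Definition repl x : nat := #|[set B in Bs | x \in B]|.
Definition lam x p : nat := #|[set B in Bs | (x \in B) && (p \in B)]|.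
(** [uncov x] is the edge relation of the graph L_x, and [leave x] is its degree sum. [uncov] is
    symmetric in all three points, so an edge of L_x can be read in L_p or L_q as well. *)
Definition uncov x p q : bool :=
  [&& x != p, x != q, p != q &
      [forall B in Bs, ~~ [&& x \in B, p \in B & q \in B]]].
Definition leave x : nat := \sum_p deg (uncov x) p.

Lemma uncovC x : symmetric (uncov x).
Proof.
move=> p q; rewrite /uncov (eq_sym p q) andbCA; do 3!congr (_ && _).
by apply: eq_forallb => B; rewrite (andbC (p \in B)).
Qed.

Lemma uncovCA x p q : uncov x p q = uncov p x q.
Proof.
rewrite /uncov (eq_sym x p); congr (_ && _); rewrite andbCA; do 2!congr (_ && _).
by apply: eq_forallb => B; rewrite andbCA.
Qed.

Lemma uncov_irr x : irreflexive (uncov x).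
Proof. by move=> p; rewrite /uncov eqxx !andbF. Qed.

Lemma uncov_self x q : uncov x x q = false.
Proof. by rewrite /uncov eqxx. Qed.

Lemma block_unique B B' x p q : B \in Bs -> B' \in Bs ->
  x != p -> x != q -> p != q ->
  [&& x \in B, p \in B & q \in B] -> [&& x \in B', p \in B' & q \in B'] -> B = B'.
Proof.
move=> BBs BBs' xp xq pq /and3P[xB pB qB] /and3P[xB' pB' qB'].
apply/eqP/negPn/negP => /(block_inter BBs BBs'); apply/negP; rewrite -ltnNge.
rewrite -(card3 xp xq pq); apply/subset_leq_card/subsetP => z.
by rewrite !inE => /orP[/orP[]|] /eqP->; apply/andP.
Qed.

Lemma cover_or_uncov x p q : x != p -> x != q -> p != q ->
  uncov x p q + #|[set B in Bs | [&& x \in B, p \in B & q \in B]]| = 1.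
Proof.
move=> xp xq pq; rewrite /uncov xp xq pq /=.
case: (boolP [forall B in Bs, _]) => [/forall_inP no|].
  apply/eqP; rewrite eqSS cards_eq0 -subset0; apply/subsetP => B.
  by rewrite inE => /andP[/no /negbTE->].
rewrite negb_forall_in => /exists_inP[B BBs /negPn xpqB].
rewrite add0n -(cards1 B); apply: eq_card => B'.
rewrite !inE; apply/andP/eqP => [[BBs' xpqB']|-> //].
exact: block_unique xpqB.
Qed.

(** Each of the n - 2 other points either is adjacent to [p] in L_x or lies on exactly one block
    through [x] and [p], and each such block holds two of them. *)
Lemma lam_deg x p : x != p -> 2 * lam x p + deg (uncov x) p = #|T| - 2.
Proof.
move=> xp; rewrite /deg card_set_sum.
have -> : #|T| - 2 = \sum_(q in ~: [set x; p]) 1.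
  by rewrite sum1_card; have := cardsC [set x; p]; rewrite cards2 xp; lia.
rewrite (bigID (mem [set x; p])) /= big1 ?add0n; last first.
  by move=> q; rewrite !inE => /orP[] /eqP->; rewrite /uncov eqxx ?andbF.
transitivity (\sum_(q in ~: [set x; p]) (uncov x p q +
    #|[set B in Bs | [&& x \in B, p \in B & q \in B]]|)); last first.
  apply: eq_bigr => q; rewrite !inE negb_or => /andP[qx qp].
  by rewrite cover_or_uncov // eq_sym.
rewrite big_split /= addnC; congr (_ + _).
  by apply: eq_bigl => q; rewrite !inE.
transitivity (\sum_(B in [set B in Bs | (x \in B) && (p \in B)])
    \sum_(q in ~: [set x; p]) (q \in B)).
  rewrite mulnC -sum_nat_const; apply: eq_bigr => B; rewrite inE.
  case/and3P=> BBs xB pB; have := card_block BBs.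
  rewrite (cardsD1 x) xB (cardsD1 p) !inE eq_sym xp pB /= => -[<-].
  rewrite -[LHS]sum1_card [LHS]big_mkcond [RHS]big_mkcond.
  by apply: eq_bigr => q _; rewrite !inE negb_or andbC; do 3!case: (_ \in _) || case: eqP.
rewrite exchange_big; apply: eq_bigr => q _ /=.
rewrite card_set_sum [LHS]big_mkcond; apply: eq_bigr => B _.
by rewrite !inE; do 4!case: (_ \in _).
Qed.

Lemma sum_lam x : \sum_(p | p != x) lam x p = 3 * repl x.
Proof.
transitivity (\sum_(B in [set B in Bs | x \in B]) \sum_(p | p != x) (p \in B)).
  rewrite exchange_big; apply: eq_bigr => p _ /=.
  rewrite /lam card_set_sum [RHS]big_mkcond; apply: eq_bigr => B _.
  by rewrite !inE; do 3!case: (_ \in _).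
rewrite /repl mulnC -sum_nat_const; apply: eq_bigr => B; rewrite inE.
case/andP=> BBs xB; have := card_block BBs.
rewrite (cardsD1 x) xB => -[<-].
rewrite -[RHS]sum1_card [LHS]big_mkcond [RHS]big_mkcond.
by apply: eq_bigr => q _; rewrite !inE; case: eqP; case: (_ \in _).
Qed.

Lemma deg_self x : deg (uncov x) x = 0.
Proof.
by apply/eqP; rewrite cards_eq0 -subset0; apply/subsetP=> q; rewrite inE uncov_self.
Qed.

Lemma repl_deg x :
  6 * repl x + leave x = (#|T| - 1) * (#|T| - 2).
Proof.
rewrite /leave (bigD1 x) //= deg_self add0n -[6]/(2 * 3) -mulnA -sum_lam big_distrr /=.
rewrite -big_split /= -(card_neq x) -sum_nat_const.
by apply: eq_bigr => p px; apply: lam_deg; rewrite eq_sym.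
Qed.

(** The Johnson bound: round down first for each pair, then for the point. *)
Lemma repl_le x : repl x <= ((#|T| - 1) * ((#|T| - 2) %/ 2)) %/ 3.
Proof.
rewrite leq_divRL // mulnC -sum_lam -(card_neq x) -sum_nat_const.
apply: leq_sum => p px; have := @lam_deg x p; rewrite eq_sym px => /(_ isT).
lia.
Qed.

Lemma deg_uncov_even x p : ~~ odd #|T| -> ~~ odd (deg (uncov x) p).
Proof.
move=> T_even; have [<-|xp] := eqVneq x p; first by rewrite deg_self.
by have := lam_deg xp; lia.
Qed.

Lemma uncov_leave_gt0 x p q : uncov x p q -> 0 < leave x.
Proof.
move=> xpq; rewrite /leave (bigD1 p) //=; apply: ltn_addr.
by apply/card_gt0P; exists q; rewrite inE.
Qed.

Lemma uncov_imset (f : T -> T) x p q :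
  injective f -> (forall B, B \in Bs -> f @: B \in Bs) ->
  uncov (f x) (f p) (f q) -> uncov x p q.
Proof.
move=> f_inj fBs; rewrite /uncov !(inj_eq f_inj) => /and4P[-> -> ->] /= /forall_inP no.
by apply/forall_inP => B /fBs/no; rewrite !mem_imset.
Qed.

(** * Packings with an involution that fixes no point and no block *)

Section FreeInvolution.
Variable s : T -> T.
Hypotheses (sK : involutive s) (s_neq : forall x, s x != x).
Hypothesis s_block : forall B, B \in Bs -> s @: B \in Bs.
Hypothesis s_block_neq : forall B, B \in Bs -> s @: B != B.

Lemma lam_even x : ~~ odd (lam x (s x)).
Proof.
apply: (@odd_card_involution _ (fun B : {set T} => s @: B)) => [B|B|B].
- by rewrite -imset_comp -[RHS]imset_id; apply: eq_imset => z /=; rewrite sK.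
- rewrite !inE => /and3P[BBs xB sxB]; rewrite s_block // imset_f // andbT.
  by rewrite -{1}(sK x) imset_f.
- by rewrite inE => /andP[/s_block_neq].
Qed.

Lemma deg_partner x : deg (uncov x) (s x) = #|T| - 2 %[mod 4].
Proof.
have := lam_even x; have := @lam_deg x (s x); rewrite eq_sym s_neq => /(_ isT).
by lia.
Qed.

Lemma leave_gt0 x : 4 %| #|T| -> 0 < #|T| -> 0 < leave x.
Proof.
move=> T4 T_gt0; have [|q xq] := @deg_gt0_edge _ (uncov x) (s x).
  by have := deg_partner x; lia.
exact: uncov_leave_gt0 xq.
Qed.

Lemma uncov_partner x q : uncov x (s x) q -> uncov x (s x) (s q).
Proof.
move=> xq; rewrite uncovCA; apply: (@uncov_imset s); rewrite ?sK //.
exact: inv_inj.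
Qed.

(** [no_involution_edge] applies in L_x with [y := s x]: its image [s y = x] is isolated there, and
    its degree is 2 mod 4, hence positive. *)
Lemma leave8_partner x : 4 %| #|T| -> 0 < #|T| ->
  leave x = 8 ->
  (forall p, uncov x p (s p) = false) /\ exists a, uncov x (s x) a.
Proof.
move=> T4 T_gt0 sum8; have T_even : ~~ odd #|T| by lia.
have dsx : 0 < deg (uncov x) (s x) by have := deg_partner x; lia.
split; last exact: deg_gt0_edge.
move=> p.
apply: (@no_involution_edge _ _ (uncovC x) (@uncov_irr x) _ sum8 s (s x)) => //.
- by move=> q; apply: deg_uncov_even.
- exact: uncov_partner.
- by move=> q; rewrite sK uncov_self.
Qed.

(** The same uncovered triple, read in L_a, is an edge joining [x] to [s x]. *)
Lemma uncov_partner_leave x a : 4 %| #|T| -> 0 < #|T| ->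
  uncov x (s x) a -> leave a != 8.
Proof.
move=> T4 T_gt0 xa; apply/eqP => /leave8_partner[] // /(_ x).
by rewrite uncovCA uncovC xa.
Qed.

(** Here [s x] has degree divisible by 4 in L_x, but at most two possible neighbours, so it is
    isolated. Then [p] has at most one possible neighbour, and its even degree must be 0. *)
Lemma uncov_eq0_of_small_support (S : {set T}) : 4 %| #|T| - 2 -> ~~ odd #|T| ->
  #|S| <= 4 -> (forall z p q, uncov z p q -> z \in S) ->
  forall x p q, uncov x p q = false.
Proof.
move=> T4 T_even S4 supp x p q; apply/negP => xpq.
have supp2 y z w : uncov y z w -> (z \in S) && (w \in S).
  move=> yzw; rewrite (supp z y w) 1?uncovCA //.
  by rewrite (supp w y z) // uncovCA uncovC.
have xS := supp _ _ _ xpq; have /andP[pS qS] := supp2 _ _ _ xpq.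
(* The involution maps uncovered triples to uncovered triples. *)
have sxS : s x \in S.
  apply: (supp _ (s p) (s q)); apply: (@uncov_imset s); rewrite ?sK //.
  exact: inv_inj.
have uncov_ne y z w : uncov y z w -> [&& w != y & w != z].
  by case/and4P=> _; rewrite eq_sym (eq_sym z) => -> ->.
have c2 : #|S :\ x :\ s x| <= 2.
  by move: S4; rewrite (cardsD1 x S) xS (cardsD1 (s x)) !inE s_neq sxS.
have nosx w : uncov x (s x) w = false.
  apply/negP => xw; have := deg_partner x.
  have : 0 < deg (uncov x) (s x) by apply/card_gt0P; exists w; rewrite inE.
  have : deg (uncov x) (s x) <= 2.
    apply: leq_trans c2.
    apply/subset_leq_card/subsetP => z; rewrite !inE => xz.
    by have /andP[-> ->] := uncov_ne _ _ _ xz; case/andP: (supp2 _ _ _ xz).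
  by lia.
have psx : p != s x by apply: contraTneq xpq => ->; rewrite nosx.
have px : p != x by case/andP: (uncov_ne _ q p (etrans (uncovC _ _ _) xpq)).
have := deg_uncov_even x p T_even.
have : 0 < deg (uncov x) p by apply/card_gt0P; exists q; rewrite inE.
have : deg (uncov x) p <= 1.
  suff c1 : #|S :\ x :\ s x :\ p| <= 1.
    apply: leq_trans c1; apply/subset_leq_card/subsetP => z; rewrite !inE => xz.
    have /andP[-> ->] := uncov_ne _ _ _ xz; case/andP: (supp2 _ _ _ xz) => _ ->.
    by rewrite !andbT; apply: contraTneq xz => ->; rewrite uncovC nosx.
  by move: c2; rewrite (cardsD1 p) !inE psx px pS.
by lia.
Qed.

(** * A further symmetry of order three *)

Section OrderThree.
Variable t : T -> T.
Hypotheses (t3 : forall x, t (t (t x)) = x) (t_neq : forall x, t x != x).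
Hypothesis t_block : forall B, B \in Bs -> t @: B \in Bs.
Hypothesis t_block_neq : forall B, B \in Bs -> t @: B != B.

(** A block through the orbit and its image under [t] would share three points, so [t] would fix the
    block. *)
Lemma uncov_order3_orbit x : uncov x (t x) (t (t x)).
Proof.
have xt : x != t x by rewrite eq_sym.
have xtt : x != t (t x) by rewrite -{1}(t3 x).
have ttt : t x != t (t x) by rewrite eq_sym.
rewrite /uncov xt xtt ttt; apply/forall_inP => B BBs; apply/negP => xB.
have := t_block_neq BBs; rewrite eq_sym => /eqP; apply.
apply: (block_unique _ _ xt xtt ttt xB) => //; first exact: t_block.
by case/and3P: xB => xB txB ttxB; rewrite -{1}(t3 x) !imset_f.
Qed.

(** The orbit gives the edge from [t x] to [t (t x)] in L_x, and [involution_nbr_edge] forces one of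
    its ends to be adjacent to [s x]. *)
Lemma exists_uncov_partner_orbit x : 4 %| #|T| -> 0 < #|T| ->
  t x != s x -> t (t x) != s x -> leave x = 8 ->
  uncov x (s x) (t x) || uncov x (s x) (t (t x)).
Proof.
move=> T4 T_gt0 tsx ttsx sum8; have T_even : ~~ odd #|T| by lia.
have dsx : 0 < deg (uncov x) (s x) by have := deg_partner x; lia.
have [||a xa] := @involution_nbr_edge _ _ (uncovC x) (@uncov_irr x) _ sum8
  s (s x) _ _ sK s_neq _ dsx (uncov_order3_orbit x) tsx ttsx.
- by move=> q; apply: deg_uncov_even.
- exact: uncov_partner.
by case/orP => /eqP <-; rewrite xa ?orbT.
Qed.

End OrderThree.
End FreeInvolution.
End QuadruplePacking.

(** * Orthogonal codes as packings *)

(** With n = uv divisible by 6, (n - 1)(n - 2)/2 is 1 mod 3, so rounding loses 2 out of (n - 1)(n -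
    2). The bound 3 <= N keeps N - 1 and N - 2 from being truncated. *)
Lemma Nval_mod0 u v : 0 < u * v -> u * v %% 6 = 0 ->
  6 * Nval u v + 2 = (u * v - 1) * (u * v - 2) /\ 3 <= Nval u v.
Proof.
rewrite /Nval; move: (u * v) => n n_gt0 n0.
have [k ->] : exists k, n = 6 * k + 6 by exists (n %/ 6 - 1); lia.
have -> : (6 * k + 6 - 2) %/ 2 = 3 * k + 2 by lia.
have -> : (6 * k + 6 - 1) * (3 * k + 2) = (6 * k * k + 9 * k + 3) * 3 + 1 by nia.
by rewrite divnMDl //; split; nia.
Qed.

Lemma Nval_mod24 u v : u * v %% 6 = 2 \/ u * v %% 6 = 4 ->
  6 * Nval u v = (u * v - 1) * (u * v - 2).
Proof.
rewrite /Nval; move: (u * v) => n [] n2.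
  have [k ->] : exists k, n = 6 * k + 2 by exists (n %/ 6); lia.
  have -> : (6 * k + 2 - 2) %/ 2 = 3 * k by lia.
  have -> : (6 * k + 2 - 1) * (3 * k) = (6 * k + 1) * k * 3 by nia.
  by rewrite mulnK //; nia.
have [k ->] : exists k, n = 6 * k + 4 by exists (n %/ 6); lia.
have -> : (6 * k + 4 - 2) %/ 2 = 3 * k + 1 by lia.
have -> : (6 * k + 4 - 1) * (3 * k + 1) = (2 * k + 1) * (3 * k + 1) * 3 by nia.
by rewrite mulnK //; nia.
Qed.

Lemma half_turn v : ~~ odd v.+1 -> exists2 h : 'I_v.+1, h = v.+1./2 :> nat &
  h != 0%R /\ (h + h = 0)%R.
Proof.
move=> v_even; exists (inord v.+1./2); first by rewrite inordK //; lia.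
have hE : (inord v.+1./2 : 'I_v.+1) = v.+1./2 :> nat by rewrite inordK //; lia.
split; first by rewrite -val_eqE /= hE; lia.
by apply: val_inj; rewrite /= hE addnn; have -> : v.+1./2.*2 = v.+1; [lia|rewrite modnn].
Qed.

Lemma third_turn v : 3 %| v.+1 -> exists2 t : 'I_v.+1, t = v.+1 %/ 3 :> nat &
  t != 0%R /\ (t + t + t = 0)%R.
Proof.
move=> v3; exists (inord (v.+1 %/ 3)); first by rewrite inordK //; lia.
have tE : (inord (v.+1 %/ 3) : 'I_v.+1) = v.+1 %/ 3 :> nat by rewrite inordK //; lia.
split; first by rewrite -val_eqE /= tE; lia.
apply: val_inj; rewrite /= tE modnDml.
by have -> : v.+1 %/ 3 + v.+1 %/ 3 + v.+1 %/ 3 = v.+1; [lia|rewrite modnn].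
Qed.

(** * Blocks obtained from the cyclic shifts of codewords *)

Section Code.
Variables (u v : nat).
Local Notation point := ('I_u * 'I_v.+1)%type.
Local Notation word := 'M[bool]_(u, v.+1).

(** The number of columns is written [v.+1] so that ['I_v.+1] carries the group of integers mod v +
    1. *)
Definition shift_block (A : word) (r : 'I_v.+1) : {set point} :=
  [set p : point | A p.1 (p.2 + r)%R].

Definition blocks (C : {set word}) : {set {set point}} :=
  [set shift_block z.1 z.2 | z in [set z : word * 'I_v.+1 | z.1 \in C]].

Definition rot (r : 'I_v.+1) (p : point) : point := (p.1, (p.2 + r)%R).

Definition rowdeg (C : {set word}) (i : 'I_u) : nat :=
  \sum_(A in C) \sum_(j < v.+1) (A i j : nat).

Lemma colshiftE (j r : 'I_v.+1) : colshift j r = (j + r)%R.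
Proof. exact: val_inj. Qed.

Lemma card_shift_blockI A B r s :
  #|shift_block A r :&: shift_block B s| = corr A B (s - r)%R.
Proof.
transitivity #|[set p : point | A p.1 (p.2 + r)%R && B p.1 (p.2 + s)%R]|.
  by apply: eq_card => p; rewrite !inE.
rewrite card_set_sum -(pair_bigA _ (fun i j => A i (j + r)%R && B i (j + s)%R : nat)) /=.
apply: eq_bigr => i _.
rewrite (reindex_inj (addIr (- r)%R)); apply: eq_bigr => j _.
by rewrite colshiftE addrNK -addrA (addrC (- r)%R).
Qed.

Lemma card_shift_block A r : #|shift_block A r| = hweight A.
Proof.
rewrite -[shift_block A r]setIid card_shift_blockI subrr.
apply: eq_bigr => i _; apply: eq_bigr => j _.
by rewrite colshiftE addr0 andbb.
Qed.

Lemma rot_shift_block A r s : rot s @: shift_block A r = shift_block A (r - s)%R.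
Proof.
apply/setP => p; rewrite !inE; apply/imsetP/idP => [[q]|Ap].
  by rewrite inE => Aq -> /=; rewrite addrACA subrr addr0.
exists (p.1, (p.2 - s)%R); rewrite ?inE /= -?addrA 1?(addrC (- s)%R) //.
by rewrite /rot /= addrNK -surjective_pairing.
Qed.

Lemma rot_neq r p : r != 0%R -> rot r p != p.
Proof.
apply: contraNneq => /(congr1 snd)/= /eqP.
by rewrite -subr_eq0 addrAC subrr add0r.
Qed.

Lemma rot_involutive (h : 'I_v.+1) : (h + h = 0)%R -> involutive (rot h).
Proof. by move=> hh [i j]; rewrite /rot /= -addrA hh addr0. Qed.

Lemma card_point : #|{: point}| = u * v.+1.
Proof. by rewrite card_prod !card_ord. Qed.

Lemma point_gt0 (i : 'I_u) : 0 < u * v.+1.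
Proof. by rewrite muln_gt0 (leq_ltn_trans _ (ltn_ord i)). Qed.

Section OOC.
Variable C : {set word}.
Hypothesis C_OOC : is_OOC C.

Lemma OOC_weight A : A \in C -> hweight A = 4.
Proof. by move=> AC; case/andP: C_OOC => /forall_inP/(_ A AC)/eqP. Qed.

Lemma OOC_corr A B (r : 'I_v.+1) : A \in C -> B \in C -> (A != B) || (r != 0%R) ->
  corr A B r <= 2.
Proof.
move=> AC BC ABr; case/andP: C_OOC => _ /forall_inP/(_ A AC)/forall_inP/(_ B BC).
by move/forallP/(_ r)/implyP; apply.
Qed.

(** Equal shifts of different origin would have correlation 4. So [blocks] merges no shifts, and
    nonzero rotations fix no block. *)
Lemma shift_block_inj (y z : word * 'I_v.+1) : y.1 \in C -> z.1 \in C ->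
  shift_block y.1 y.2 = shift_block z.1 z.2 -> y = z.
Proof.
case: y z => [A r] [B s] /= AC BC e; apply/eqP/negPn/negP => ne.
have := card_shift_blockI A B r s; rewrite -e setIid card_shift_block OOC_weight //.
move=> e4; have := @OOC_corr A B (s - r)%R AC BC; rewrite -e4.
move: ne; rewrite -pair_eqE /= negb_and subr_eq0 (eq_sym r).
by move=> -> /(_ isT).
Qed.

Lemma card_blocks B : B \in blocks C -> #|B| = 4.
Proof.
by case/imsetP => z; rewrite inE => zC ->; rewrite card_shift_block OOC_weight.
Qed.

Lemma blocks_inter B B' :
  B \in blocks C -> B' \in blocks C -> B != B' -> #|B :&: B'| <= 2.
Proof.
case/imsetP => -[A r]; rewrite inE /= => AC ->.
case/imsetP => -[A' r']; rewrite inE /= => AC' -> ne.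
rewrite card_shift_blockI OOC_corr // subr_eq0.
by apply: contraR ne; rewrite negb_or !negbK => /andP[/eqP-> /eqP->].
Qed.

Lemma rot_blocks r B : B \in blocks C -> rot r @: B \in blocks C.
Proof.
case/imsetP => -[A s]; rewrite inE /= => AC ->; rewrite rot_shift_block.
by apply/imsetP; exists (A, s - r)%R; rewrite ?inE.
Qed.

Lemma rot_blocks_neq r B : r != 0%R -> B \in blocks C -> rot r @: B != B.
Proof.
move=> r0 /imsetP[[A s]]; rewrite inE /= => AC ->; rewrite rot_shift_block.
apply: contraNneq r0 => /(@shift_block_inj (A, s - r)%R (A, s) AC AC)[].
by move/eqP; rewrite -subr_eq0 addrAC subrr add0r oppr_eq0.
Qed.

(** As the shift runs over all columns, a fixed point of row [p.1] meets each entry of that row of a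
    codeword once. *)
Lemma repl_rowdeg p : repl (blocks C) p = rowdeg C p.1.
Proof.
pose Z := [set z : word * 'I_v.+1 | (z.1 \in C) && (p \in shift_block z.1 z.2)].
have -> : repl (blocks C) p = #|Z|.
  rewrite -(@card_in_imset _ _ (fun z => shift_block z.1 z.2) (mem Z)).
    apply: eq_card => B; rewrite !inE; apply/andP/imsetP => [[/imsetP[z zC ->] pz]|[z]].
      by exists z => //; rewrite inE pz; rewrite inE in zC; rewrite zC.
    by rewrite inE => /andP[zC pz] ->; rewrite pz; split=> //; apply: imset_f; rewrite inE.
  move=> y z; rewrite !inE => /andP[yC _] /andP[zC _]; exact: shift_block_inj.
rewrite card_set_sum /rowdeg [RHS]big_mkcond.
rewrite -(pair_bigA _ (fun A r => (A \in C) && (p \in shift_block A r) : nat)) /=.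
apply: eq_bigr => A _; case: (A \in C) => /=; last by rewrite big1.
rewrite [RHS](reindex_inj (addrI p.2)).
by apply: eq_bigr => r _; rewrite inE.
Qed.

Lemma sum_rowdeg : \sum_i rowdeg C i = #|C| * 4.
Proof.
rewrite /rowdeg exchange_big /= -sum_nat_const; apply: eq_bigr => A AC.
exact: OOC_weight.
Qed.

Lemma repl_deg_row (p : point) :
  6 * rowdeg C p.1 + leave (blocks C) p
    = (u * v.+1 - 1) * (u * v.+1 - 2).
Proof.
rewrite -repl_rowdeg -card_point; apply: repl_deg.
- exact: card_blocks.
- exact: blocks_inter.
Qed.

Lemma rowdeg_le i : rowdeg C i <= Nval u v.+1.
Proof.
rewrite -(repl_rowdeg (i, ord0)) /Nval -card_point; apply: repl_le.
- exact: card_blocks.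
- exact: blocks_inter.
Qed.

(** Equality with N would leave degree sum exactly 2. *)
Lemma rowdeg_le_mod0 i : u * v.+1 %% 6 = 0 -> rowdeg C i <= Nval u v.+1 - 1.
Proof.
move=> n0; have [eN N3] := Nval_mod0 (point_gt0 i) n0.
have := repl_deg_row (i, ord0); rewrite -eN => /= e.
have := rowdeg_le i; rewrite leq_eqVlt => /orP[/eqP eN'|]; last by lia.
suff /eqP : leave (blocks C) (i, ord0) != 2 by lia.
apply: sum_deg_neq2; [exact: uncovC|exact: uncov_irr|move=> q].
apply: deg_uncov_even; [exact: card_blocks|exact: blocks_inter|].
by rewrite card_point; lia.
Qed.

(** * Codes with an even number of columns *)

Section EvenLength.
Variable h : 'I_v.+1.
Hypotheses (h_neq0 : h != 0%R) (hh : (h + h = 0)%R).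

Local Notation rK := (rot_involutive hh).
Local Notation r_neq := (fun p => @rot_neq h p h_neq0).
Local Notation rB := (@rot_blocks h).
Local Notation rB_neq := (fun B => @rot_blocks_neq h B h_neq0).

(** Here 6N = (n - 1)(n - 2), so equality with N would leave no uncovered triple, against
    [leave_gt0]. *)
Lemma rowdeg_le_mod4 i : (u * v.+1 %% 12 = 4) \/ (u * v.+1 %% 12 = 8) ->
  rowdeg C i <= Nval u v.+1 - 1.
Proof.
move=> n4; have eN : 6 * Nval u v.+1 = (u * v.+1 - 1) * (u * v.+1 - 2).
  by apply: Nval_mod24; lia.
have := repl_deg_row (i, ord0); rewrite -eN => /= e.
have := rowdeg_le i; rewrite leq_eqVlt => /orP[/eqP eN'|]; last by lia.
have := leave_gt0 card_blocks blocks_inter rK r_neq rB rB_neq (i, ord0).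
rewrite card_point => /(_ _ (point_gt0 i)) H.
have {H} : 0 < leave (blocks C) (i, ord0) by apply: H; lia.
by lia.
Qed.

Lemma rowdeg_leave8 (p : point) : u * v.+1 %% 12 = 0 -> rowdeg C p.1 = Nval u v.+1 - 1 ->
  leave (blocks C) p = 8.
Proof.
move=> n0; have [|eN N3] := Nval_mod0 (point_gt0 p.1); first by lia.
by have := repl_deg_row p; rewrite -eN; lia.
Qed.

(** If row [i] attains N - 1, some [a] is adjacent in L_x to the partner of x, and then the row of
    [a] does not attain it. *)
Lemma exists_row_deficit (i : 'I_u) : u * v.+1 %% 12 = 0 ->
  exists j, rowdeg C j != Nval u v.+1 - 1.
Proof.
move=> n0; have n_gt0 := point_gt0 i.
have [ei|] := eqVneq (rowdeg C i) (Nval u v.+1 - 1); last by exists i.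
have [||_ [a xa]] := leave8_partner card_blocks blocks_inter rK r_neq rB rB_neq
  _ _ (@rowdeg_leave8 (i, ord0) n0 ei); rewrite ?card_point //; first by lia.
exists a.1.
have := @uncov_partner_leave _ _ card_blocks blocks_inter _ rK r_neq rB rB_neq _ _ _ _ xa.
rewrite card_point => /(_ _ n_gt0) H.
by apply: contra_neq (H _) => [/(rowdeg_leave8 n0) //|]; lia.
Qed.

Lemma rowdeg_le_mod12 i : u * v.+1 %% 12 = 0 -> 6 %| v.+1 -> h = v.+1./2 :> nat ->
  rowdeg C i <= Nval u v.+1 - 2.
Proof.
move=> n0 v6 hE; have v3 : 3 %| v.+1 by lia.
have n_gt0 := point_gt0 i.
have lt := @rowdeg_le_mod0 i; have {lt}: rowdeg C i <= Nval u v.+1 - 1 by apply: lt; lia.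
rewrite leq_eqVlt => /orP[/eqP ei|]; last by lia.
have [t tE [t_neq0 ttt]] := third_turn v3.
have t3 (p : point) : rot t (rot t (rot t p)) = p.
  by case: p => a b; rewrite /rot /= -!addrA (addrA t) ttt addr0.
(* The degree sum is 8 at every point of row [i], including the rotations by a third turn, which
   stay in that row. *)
have sum8 := fun j => @rowdeg_leave8 (i, j) n0 ei.
have T4 : 4 %| #|{: point}| by rewrite card_point; lia.
have T_gt0 : 0 < #|{: point}| by rewrite card_point.
have : uncov (blocks C) (i, 0%R) (rot h (i, 0%R)) (rot t (i, 0%R)) ||
       uncov (blocks C) (i, 0%R) (rot h (i, 0%R)) (rot t (rot t (i, 0%R))).
  apply: (exists_uncov_partner_orbit card_blocks blocks_inter rK r_neq rB rB_neq t3
    (fun p => rot_neq p t_neq0) (@rot_blocks t) (fun B => @rot_blocks_neq t B t_neq0)) => //.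
  - by rewrite /rot xpair_eqE /= eqxx !add0r -val_eqE /= tE hE; lia.
  - rewrite /rot xpair_eqE /= eqxx !add0r -val_eqE /= tE hE modn_small; lia.
by case/orP => /(uncov_partner_leave card_blocks blocks_inter rK r_neq rB rB_neq T4 T_gt0);
  rewrite sum8.
Qed.

Lemma card_le_v2 : v.+1 = 2 -> (u %% 12 = 7) \/ (u %% 12 = 11) ->
  #|C| <= (u * Nval u v.+1) %/ 4 - 1.
Proof.
move=> v2 u7; have eN : 6 * Nval u v.+1 = (u * v.+1 - 1) * (u * v.+1 - 2).
  by apply: Nval_mod24; rewrite v2; lia.
(* In both residue classes N = (2u - 1)(u - 1)/3 is twice an odd number, and [u] is odd. *)
have uN4 : (u * Nval u v.+1) %% 4 = 2.
  move: eN; rewrite v2; move: (Nval u 2) => N eN.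
  have [k [uE|uE]] : exists k, u = 12 * k + 7 \/ u = 12 * k + 11.
    by exists (u %/ 12); lia.
  - have -> : N = (24 * k + 13) * (2 * k + 1) * 2 by rewrite uE in eN; nia.
    have : odd (u * ((24 * k + 13) * (2 * k + 1))).
      by rewrite !oddM; apply/and3P; split; lia.
    by rewrite !mulnA; lia.
  - have -> : N = (8 * k + 7) * (6 * k + 5) * 2 by rewrite uE in eN; nia.
    have : odd (u * ((8 * k + 7) * (6 * k + 5))).
      by rewrite !oddM; apply/and3P; split; lia.
    by rewrite !mulnA; lia.
have sumd : \sum_i rowdeg C i + \sum_i (Nval u v.+1 - rowdeg C i) = u * Nval u v.+1.
  have -> : u * Nval u v.+1 = \sum_(i < u) Nval u v.+1 by rewrite sum_nat_const card_ord.
  by rewrite -big_split; apply: eq_bigr => i _; apply: subnKC; apply: rowdeg_le.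
rewrite sum_rowdeg in sumd; rewrite leqNgt; apply/negP => C_big.
pose R := [set i | rowdeg C i < Nval u v.+1].
(* [C_big] makes the total deficit at most 2, and each row of [R] contributes at least 1. *)
have R2 : #|R| <= 2.
  suff : #|R| <= \sum_i (Nval u v.+1 - rowdeg C i) by lia.
  by rewrite card_set_sum; apply: leq_sum => i _; case: ltnP; lia.
pose S : {set point} := setX R setT.
have leave_supp (z : point) : 0 < leave (blocks C) z -> z \in S.
  case: z => i j Lz; rewrite !inE andbT /=.
  by have := repl_deg_row (i, j); rewrite -eN /=; lia.
have S4 : #|S| <= 4 by rewrite cardsX cardsT card_ord v2; lia.
have no_uncov : forall x p q, uncov (blocks C) x p q = false.
  apply: (uncov_eq0_of_small_support card_blocks blocks_inter rK r_neq rB rB_neq _ _ S4).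
  - by rewrite card_point v2; lia.
  - by rewrite card_point v2; lia.
  - by move=> z p q /uncov_leave_gt0; apply: leave_supp.
(* With no uncovered triple every row is full, so 4|C| = uN, which contradicts uN being 2 mod 4. *)
have full i : rowdeg C i = Nval u v.+1.
  have L0 : leave (blocks C) (i, ord0) = 0.
    apply/eqP; rewrite -leqn0 leqNgt; apply/negP => /edge_of_sum_deg[p [q]].
    by rewrite no_uncov.
  by have := repl_deg_row (i, ord0); rewrite -eN L0 /=; lia.
have : \sum_i (Nval u v.+1 - rowdeg C i) = 0 by rewrite big1 // => i _; rewrite full subnn.
by lia.
Qed.

End EvenLength.

End OOC.
End Code.

(** * Assembly of the cases of the bound *)

Theorem theorem5p7 (u v : nat) (hu : 0 < u) (hv : 0 < v) :
  Phi u v <= Jstar u v.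
Proof.
apply/bigmax_leqP => C; case: v hv C => // v _ C C_OOC.
have bound M : (forall i, rowdeg C i <= M) -> #|C| <= (u * M) %/ 4.
  move=> dM; rewrite leq_divRL // -sum_rowdeg //.
  have -> : u * M = \sum_(i < u) M by rewrite sum_nat_const card_ord.
  exact: leq_sum.
rewrite /Jstar; case: ifP => [/andP[u7 /eqP v2]|_].
  have [|h _ [h_neq0 hh]] := @half_turn v; first by rewrite v2.
  by apply: (card_le_v2 C_OOC h_neq0 hh v2); lia.
case: ifP => [/orP[/andP[n0 _]|/andP[n4 v_even]]|_].
- by apply: bound => i; apply: rowdeg_le_mod0 => //; apply/eqP.
- have [h _ [h_neq0 hh]] := half_turn v_even.
  by apply: bound => i; apply: (rowdeg_le_mod4 C_OOC h_neq0 hh); lia.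
case: ifP => [/andP[u0 v2]|_].
  have [|h _ [h_neq0 hh]] := @half_turn v; first by lia.
  have n0 : u * v.+1 %% 12 = 0 by rewrite -modnMml (eqP u0).
  have [j dj] := exists_row_deficit C_OOC h_neq0 hh (Ordinal hu) n0.
  have n06 : u * v.+1 %% 6 = 0 by lia.
  have dle i := rowdeg_le_mod0 C_OOC i n06.
  (* As 4 divides u, the quotient u(N - 1)/4 is exact, so one deficient row lowers the bound by a
     full codeword. *)
  suff : #|C| * 4 < u * (Nval u v.+1 - 1).
    have : 4 %| u * (Nval u v.+1 - 1) by apply: dvdn_mulr; lia.
    by move: (u * (_ - 1)) => m; lia.
  have -> : u * (Nval u v.+1 - 1) = \sum_(i < u) (Nval u v.+1 - 1).
    by rewrite sum_nat_const card_ord.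
  rewrite -sum_rowdeg //.
  rewrite (bigD1 j) //= [ltnRHS](bigD1 j) //= -addSn; apply: leq_add.
    by have := dle j; lia.
  by apply: leq_sum => i _; apply: dle.
case: ifP => [/andP[/eqP n0 v6]|_]; last by apply: bound => i; apply: rowdeg_le.
have [|h hE [h_neq0 hh]] := @half_turn v; first by lia.
by apply: bound => i; apply: (rowdeg_le_mod12 C_OOC h_neq0 hh _ n0 v6 hE).
Qed.
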